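(* Let $r\ge1$, let $b_1\ge\cdots\ge b_r$ be integers with $b_i\ge i$ for all $i$, and let $x=(i,c)\le y=(j,d)$ be elements of the Ferrers-cell poset $F_{\mathbf b}$. Put $h=(i-j)+(d-c)$. Let $\mathcal W_{\mathbf b}(x,y)$ be the set of words in $\{L,R\}$ with exactly $i-j$ letters $L$ and $d-c$ letters $R$ such that, for every prefix with $L_k$ letters $L$ and $R_k$ letters $R$, $c+R_k\le b_{i-L_k}$. For such a word $w=w_1\cdots w_h$ set $D_{x,y}(w)=\{p\in\{1,\dots,h-1\}:w_p=R,\ w_{p+1}=L\}$. Then, with the induced rank $\rho_{x,y}(z)=\rho(z)-\rho(x)$ on the interval $[x,y]$, $$\mathbb{H}_{[x,y],\rho_{x,y}}(q,t)=\sum_{w\in\mathcal W_{\mathbf b}(x,y)}q^{\sum_{p\in D_{x,y}(w)}p}\,t^{|D_{x,y}(w)|}.$$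
   Context: $q$-Zeta numerator: let $P$ be a finite graded poset with a unique maximum and rank function $\rho:P\to\{0,\dots,H\}$, where $H$ is the maximal rank. For $m\ge 0$ put $A_m(P,\rho;q)=\sum_{x_1\le\cdots\le x_m}q^{\rho(x_1)+\cdots+\rho(x_m)}$ (sum over weak chains in $P$; $A_0=1$). The numerator $\mathbb{H}_{P,\rho}(q,t)$ is the polynomial determined by $\sum_{m\ge 0}A_m(P,\rho;q)t^m=\mathbb{H}_{P,\rho}(q,t)/\prod_{a=0}^{H}(1-q^at)$. Ferrers-cell poset: $F_{\mathbf b}=\{(i,c):1\le i\le r,\ i\le c\le b_i\}$, ordered by $(i,c)\le(j,d)\iff i\ge j$ and $c\le d$, with rank $\rho(i,c)=c-i$. *)

(* Defs.v *)
From HB Require Import structures.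
From mathcomp Require Import all_boot all_order all_algebra.

Set Implicit Arguments.
Unset Strict Implicit.
Unset Printing Implicit Defensive.

Import Order.TTheory GRing.Theory Num.Theory.
Local Open Scope ring_scope.

(* Polynomials in q and t are elements of {poly {poly int}}: the outer
   variable is t, the inner one is q. *)
Notation qtpoly := {poly {poly int}}.
Definition tvar : qtpoly := 'X.
Definition qvar : qtpoly := ('X : {poly int})%:P.

Section QZeta.
Context {d : Order.disp_t} {P : finPOrderType d}.
Variable rho : P -> nat.

(* <=%O is transitive, so the sorted m-tuples are the weak chains. *)
Definition qzeta_coef (m : nat) : {poly int} :=
  \sum_(s : m.-tuple P | sorted <=%O s) 'X^(\sum_(z <- s) rho z)%N.

Definition max_rank : nat := \max_(z : P) rho z.

Definition qzeta_denom : qtpoly :=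
  \prod_(0 <= a < max_rank.+1) (1 - qvar ^+ a * tvar).

(* The identity of formal power series in t
     (\sum_m A_m t^m) * \prod_a (1 - q^a t) = N,
   compared coefficient by coefficient. *)
Definition is_qzeta_numerator (N : qtpoly) : Prop :=
  forall n : nat,
    \sum_(m < n.+1) qzeta_coef m * qzeta_denom`_(n - m) = N`_n.

Lemma is_qzeta_numerator_uniq (N1 N2 : qtpoly) :
  is_qzeta_numerator N1 -> is_qzeta_numerator N2 -> N1 = N2.
Proof. by move=> h1 h2; apply/polyP => n; rewrite -h1 -h2. Qed.

End QZeta.

Section Interval.
Context {d : Order.disp_t} {P : finPOrderType d}.

Record order_interval (x y : P) := OrderInterval {
  oitv_val : P; _ : (x <= oitv_val <= y)%O
}.

Variables x y : P.
HB.instance Definition _ := [isSub for @oitv_val x y].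
HB.instance Definition _ := [Finite of order_interval x y by <:].
HB.instance Definition _ := [SubChoice_isSubPOrder of order_interval x y by <: with d].

Definition interval_rank (rho : P -> nat) (z : order_interval x y) : nat :=
  (rho (val z) - rho x)%N.

End Interval.

Section Ferrers.
Variables (r : nat) (b : nat -> nat).

(* Rows and columns are numbered from 1, and only b 1, ..., b r matter. *)
Definition is_cell (p : nat * nat) : bool :=
  (1 <= p.1 <= r)%N && (p.1 <= p.2 <= b p.1)%N.

(* The ordinal bounds only serve to make the type finite; they exclude no
   pair satisfying is_cell. *)
Definition col_bound : nat := \max_(i < r.+1) b i.

Record ferrers := FerrersCell {
  cell_pos : 'I_r.+1 * 'I_col_bound.+1;
  _ : is_cell (nat_of_ord cell_pos.1, nat_of_ord cell_pos.2)
}.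

HB.instance Definition _ := [isSub for cell_pos].
HB.instance Definition _ := [Finite of ferrers by <:].

Definition cell_row (x : ferrers) : nat := (cell_pos x).1.
Definition cell_col (x : ferrers) : nat := (cell_pos x).2.

Lemma exists_cell (p : nat * nat) :
  is_cell p -> exists x : ferrers, (cell_row x, cell_col x) = p.
Proof.
case: p => i c Hp; have /andP[/andP[_ /= ir] /andP[_ /= cb]] := Hp.
have ir' : (i < r.+1)%N by [].
have cm : (c < col_bound.+1)%N.
  by rewrite ltnS (leq_trans cb) // (leq_bigmax (Ordinal ir')).
by exists (@FerrersCell (Ordinal ir', Ordinal cm) Hp).
Qed.

Definition ferrers_le (x y : ferrers) : bool :=
  (cell_row y <= cell_row x)%N && (cell_col x <= cell_col y)%N.

Lemma ferrers_le_refl : reflexive ferrers_le.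
Proof. by move=> x; rewrite /ferrers_le !leqnn. Qed.

Lemma ferrers_le_anti : antisymmetric ferrers_le.
Proof.
move=> x y /andP[/andP[yx1 xy2] /andP[xy1 yx2]].
apply/val_inj; rewrite /= [cell_pos x]surjective_pairing.
rewrite [cell_pos y]surjective_pairing; congr pair; apply/val_inj/anti_leq.
  exact/andP.
exact/andP.
Qed.

Lemma ferrers_le_trans : transitive ferrers_le.
Proof.
move=> y x z /andP[yx1 xy2] /andP[zy1 yz2].
by rewrite /ferrers_le (leq_trans zy1) // (leq_trans xy2).
Qed.

Fact ferrers_display : Order.disp_t. Proof. exact: Order.Disp tt tt. Qed.

HB.instance Definition _ := Order.Le_isPOrder.Build ferrers_display ferrers
  ferrers_le_refl ferrers_le_anti ferrers_le_trans.

Definition ferrers_rank (x : ferrers) : nat := (cell_col x - cell_row x)%N.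

End Ferrers.

Inductive letter := L | R.

Definition bool_of_letter (l : letter) : bool := if l is L then true else false.
Definition letter_of_bool (e : bool) : letter := if e then L else R.
Lemma bool_of_letterK : cancel bool_of_letter letter_of_bool.
Proof. by case. Qed.
HB.instance Definition _ := Finite.copy letter (can_type bool_of_letterK).

Section Words.
Variables (r : nat) (b : nat -> nat) (x y : ferrers r b).

Definition word_length : nat :=
  ((cell_row x - cell_row y) + (cell_col y - cell_col x))%N.

Definition words : {set word_length.-tuple letter} :=
  [set w : word_length.-tuple letter |
    [&& count_mem L w == (cell_row x - cell_row y)%N,
        count_mem R w == (cell_col y - cell_col x)%N &
        [forall k : 'I_word_length.+1,
          (cell_col x + count_mem R (take k w)
             <= b (cell_row x - count_mem L (take k w)))%N]]].

(* w_p is the letter of index p - 1 of the sequence w. *)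
Definition descents (w : word_length.-tuple letter) : {set 'I_word_length} :=
  [set p : 'I_word_length |
    [&& (1 <= p)%N, nth L w p.-1 == R & nth L w p == L]].

End Words.

(* Main.v *)
(* Let Z(u) be the generating function in t of the weak chains of [u, y], each
   weighted by q to the sum of the ranks, for u of rank e. Sorting chains by
   whether they contain u gives
     (1 - q^e t) Z(u) = Z(Lu) + Z(Ru) - Z(LRu),
   where Lu and Ru are the (at most two) covers of u, and LRu is their join.
   Sorting words by their first two letters shows that the numerators satisfy
     N(u) = N(Lu) + N(Ru) - (1 - q^(e+1) t) N(LRu),
   and the two recursions match after clearing denominators. *)
Require Import Defs.
From mathcomp Require Import all_boot all_order all_algebra.
From mathcomp Require Import zify ring.

Import Order.TTheory GRing.Theory Num.Theory.
Local Open Scope ring_scope.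

(** * Formal power series in [t] multiplied by polynomials *)

Definition conv (a : nat -> {poly int}) (p : qtpoly) (n : nat) : {poly int} :=
  \sum_(m < n.+1) a m * p`_(n - m).

(* The identity (\sum_m a_m t^m) * p = P of formal power series in t. *)
Definition has_numerator (a : nat -> {poly int}) (p P : qtpoly) : Prop :=
  forall n, conv a p n = P`_n.

(** The coefficient of [t^n] involves only [a 0, ..., a n], so the series may be cut down to a
    polynomial and the ring laws of polynomials apply. *)
Lemma conv_trunc (a : nat -> {poly int}) (p : qtpoly) (n N : nat) :
  (n < N)%N -> conv a p n = (\poly_(m < N) a m * p)`_n.
Proof.
move=> nN; rewrite coefM /conv; apply: eq_bigr => m _.
by rewrite coef_poly (leq_ltn_trans _ nN) // -ltnS.
Qed.

Lemma conv_mul (a : nat -> {poly int}) (p s : qtpoly) (n : nat) :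
  conv a (s * p) n = conv (conv a s) p n.
Proof.
rewrite (@conv_trunc _ _ _ n.+1) // mulrA coefM /conv; apply: eq_bigr => m _.
by rewrite -/(conv a s m) (@conv_trunc a s m n.+1).
Qed.

Lemma conv_eq (a a' : nat -> {poly int}) (p : qtpoly) :
  a =1 a' -> conv a p =1 conv a' p.
Proof. by move=> aa n; apply: eq_bigr => m _; rewrite aa. Qed.

Lemma conv1 (a : nat -> {poly int}) : conv a 1 =1 a.
Proof. by move=> n; rewrite (@conv_trunc _ _ _ n.+1) // mulr1 coef_poly ltnSn. Qed.

Lemma conv_linear_factor (a : nat -> {poly int}) (e n : nat) :
  conv a (1 - qvar ^+ e * tvar) n =
    a n - (if n is m.+1 then 'X^e * a m else 0).
Proof.
rewrite (@conv_trunc _ _ _ n.+1) // mulrBr mulr1 coefB coef_poly ltnSn.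
congr (_ - _); rewrite /qvar /tvar -rmorphXn mulrA coefMX.
case: n => [//|n] /=; rewrite coefMC coef_poly.
by rewrite ltnW // mulrC.
Qed.

Lemma has_numerator_mull (a : nat -> {poly int}) (s p P : qtpoly) :
  has_numerator a p P -> has_numerator a (s * p) (s * P).
Proof.
move=> aP n; rewrite mulrC conv_mul [s * P]mulrC coefM.
by apply: eq_bigr => m _; rewrite aP.
Qed.

(** Clears a product of denominators one factor at a time: [b] is the series left after
    multiplication by [s]. *)
Lemma has_numerator_conv (a b : nat -> {poly int}) (s p P : qtpoly) :
  conv a s =1 b -> has_numerator b p P -> has_numerator a (s * p) P.
Proof. by move=> ab bP n; rewrite conv_mul (conv_eq _ _ _ ab) bP. Qed.

Lemma eq_has_numerator (a b : nat -> {poly int}) (p P : qtpoly) :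
  a =1 b -> has_numerator b p P -> has_numerator a p P.
Proof. by move=> ab bP n; rewrite (conv_eq _ _ _ ab). Qed.

Lemma has_numeratorD (a b : nat -> {poly int}) (p P Q : qtpoly) :
  has_numerator a p P -> has_numerator b p Q ->
  has_numerator (fun m => a m + b m) p (P + Q).
Proof.
move=> aP bQ n; rewrite coefD -aP -bQ -big_split; apply: eq_bigr => m _.
exact: mulrDl.
Qed.

Lemma has_numeratorB (a b : nat -> {poly int}) (p P Q : qtpoly) :
  has_numerator a p P -> has_numerator b p Q ->
  has_numerator (fun m => a m - b m) p (P - Q).
Proof.
move=> aP bQ n; rewrite coefB -aP -bQ -sumrB; apply: eq_bigr => m _.
exact: mulrBl.
Qed.

(** * Weak chains sorted by their first element *)

Lemma big_tuple_cons (V : nmodType) (T : finType) (n : nat)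
    (Q : pred (seq T)) (F : seq T -> V) :
  \sum_(s : n.+1.-tuple T | Q s) F s =
    \sum_(z : T) \sum_(s : n.-tuple T | Q (z :: s)) F (z :: s).
Proof.
rewrite pair_big_dep /=.
rewrite (reindex (fun p : T * n.-tuple T => [tuple of p.1 :: p.2])) //=.
exists (fun s => (thead s, [tuple of behead s])) => [[z s]|s] _ /=.
  by rewrite theadE; congr pair; apply/val_inj.
by rewrite -tuple_eta.
Qed.

Lemma big_tuple0 (V : nmodType) (T : finType) (Q : pred (seq T))
    (F : seq T -> V) :
  \sum_(s : 0.-tuple T | Q s) F s = if Q [::] then F [::] else 0.
Proof.
rewrite (eq_bigl (fun s => (s == [tuple]) && Q [::])); last first.
  by move=> s; rewrite tuple0 eqxx.
by case: (Q [::]); [rewrite (eq_bigl (pred1 [tuple])) ?big_pred1_eq // => s;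
  rewrite andbT | rewrite big_pred0 // => s; rewrite andbF].
Qed.

(** The element [u] only bounds the chain from below; it is not counted in the weight. *)
Definition chain_sum {d : Order.disp_t} {P : finPOrderType d} (rho : P -> nat)
    (m : nat) (u : P) : {poly int} :=
  \sum_(s : m.-tuple P | path <=%O u s) 'X^(\sum_(z <- s) rho z)%N.

Lemma chain_sumS (d : Order.disp_t) (P : finPOrderType d) (rho : P -> nat)
    (m : nat) (u : P) :
  chain_sum rho m.+1 u =
    \sum_(z : P | (u <= z)%O) 'X^(rho z) * chain_sum rho m z.
Proof.
rewrite /chain_sum (big_tuple_cons _ _ _ (path <=%O u)
  (fun s => 'X^(\sum_(z <- s) rho z)%N)) [RHS]big_mkcond.
apply: eq_bigr => z _ /=; case: (u <= z)%O => /=; last by rewrite big_pred0_eq.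
by rewrite big_distrr; apply: eq_bigr => s _; rewrite big_cons exprD.
Qed.

Lemma qzeta_coef_chain_sum (d : Order.disp_t) (P : finPOrderType d)
    (rho : P -> nat) (m : nat) (u : P) :
  (forall z, (u <= z)%O) -> qzeta_coef rho m = chain_sum rho m u.
Proof.
by move=> umin; apply: eq_bigl => s; case: (val s) => //= z t; rewrite umin.
Qed.

(** * Chains and lattice words in a staircase region *)

Section Staircase.
Variables (g : nat -> nat) (h : nat).

(* A cell of [x, y] is encoded by its row distance l and column distance k to y;
   the cells are the pairs with g l <= k, and the rank is h - (l + k). *)
Definition stair_sum (F : nat -> nat -> {poly int}) (l k : nat) : {poly int} :=
  \sum_(i < l.+1) \sum_(c < k.+1 | (g i <= c)%N) F i c.

Fixpoint stair_chains (m l k : nat) : {poly int} :=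
  if m is m'.+1 then
    stair_sum (fun i c => 'X^(h - (i + c)) * stair_chains m' i c) l k
  else 1.

(** The word is a walk from [(l, k)] to [(0, 0)]. Only R tests the floor: for monotone [g], a letter
    L cannot leave the region. *)
Fixpoint stair_word (l k : nat) (w : seq letter) : bool :=
  match w with
  | [::] => (l == 0) && (k == 0)
  | L :: w' => if l is l'.+1 then stair_word l' k w' else false
  | R :: w' => if k is k'.+1 then (g l <= k')%N && stair_word l k' w' else false
  end.

Lemma stair_sum_row (F : nat -> nat -> {poly int}) (l k : nat) :
  (g l <= k)%N ->
  \sum_(c < k.+1 | (g l <= c)%N) F l c =
    (if k is k'.+1 then \sum_(c < k'.+1 | (g l <= c)%N) F l c else 0) + F l k.
Proof.
move=> glk; rewrite big_mkcond big_ord_recr /= glk -big_mkcond.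
by case: k glk => //; rewrite big_ord0.
Qed.

Lemma stair_sumS (F : nat -> nat -> {poly int}) (l k : nat) :
  stair_sum F l.+1 k =
    stair_sum F l k + \sum_(c < k.+1 | (g l.+1 <= c)%N) F l.+1 c.
Proof. by rewrite /stair_sum big_ord_recr. Qed.

Lemma stair_sum00 (F : nat -> nat -> {poly int}) :
  (g 0 = 0)%N -> stair_sum F 0 0 = F 0%N 0%N.
Proof. by move=> g0; rewrite /stair_sum big_ord1 stair_sum_row ?g0 // add0r. Qed.

(** The two hypotheses make [k] the least column distance allowed in row [l.+1], so this row
    contributes a single cell. *)
Lemma stair_sumL (F : nat -> nat -> {poly int}) (l k : nat) :
  (g l.+1 <= k)%N -> (if k is k'.+1 then (k' < g l.+1)%N else true) ->
  stair_sum F l.+1 k = stair_sum F l k + F l.+1 k.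
Proof.
move=> glk kg; rewrite stair_sumS stair_sum_row //.
case: k glk kg => [|k] glk kg; first by rewrite add0r.
rewrite [X in _ + (X + _)]big_pred0 ?add0r // => c; have := ltn_ord c; lia.
Qed.

Lemma stair_sumR (F : nat -> nat -> {poly int}) (k : nat) :
  (g 0 = 0)%N -> stair_sum F 0 k.+1 = stair_sum F 0 k + F 0%N k.+1.
Proof. by move=> g0; rewrite /stair_sum !big_ord1 stair_sum_row ?g0. Qed.

Lemma stair_sumLR (F : nat -> nat -> {poly int}) (l k : nat) :
  (g l.+1 <= k)%N ->
  stair_sum F l.+1 k.+1 =
    stair_sum F l k.+1 + stair_sum F l.+1 k - stair_sum F l k + F l.+1 k.+1.
Proof.
move=> glk; rewrite !stair_sumS stair_sum_row ?(leqW glk) //=.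
ring.
Qed.

(** Coefficient of [t^m] in [(1 - q^(h - (l + k)) t) Z], with [Z] the series of chains above
    [(l, k)]. It counts the chains that avoid [(l, k)]. *)
Definition stair_diff (l k m : nat) : {poly int} :=
  stair_chains m l k -
    (if m is m'.+1 then 'X^(h - (l + k)) * stair_chains m' l k else 0).

Lemma stair_diff00 m : (g 0 = 0)%N -> stair_diff 0 0 m = (m == 0)%:R.
Proof.
move=> g0; rewrite /stair_diff; case: m => [|m] /=; first by rewrite subr0.
by rewrite stair_sum00 // subrr.
Qed.

Lemma stair_diffL m l k : (g l.+1 <= k)%N ->
  (if k is k'.+1 then (k' < g l.+1)%N else true) ->
  stair_diff l.+1 k m = stair_chains m l k.
Proof.
move=> glk kg; rewrite /stair_diff; case: m => [|m] /=; first by rewrite subr0.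
by rewrite stair_sumL // addrK.
Qed.

Lemma stair_diffR m k : (g 0 = 0)%N ->
  stair_diff 0 k.+1 m = stair_chains m 0 k.
Proof.
move=> g0; rewrite /stair_diff; case: m => [|m] /=; first by rewrite subr0.
by rewrite stair_sumR // addrK.
Qed.

(* Inclusion-exclusion: a chain avoiding its lower bound lies above one of the
   two covers of it, and above both iff it lies above their join. *)
Lemma stair_diffLR m l k : (g l.+1 <= k)%N ->
  stair_diff l.+1 k.+1 m =
    stair_chains m l k.+1 + stair_chains m l.+1 k - stair_chains m l k.
Proof.
move=> glk; rewrite /stair_diff; case: m => [|m] /=.
  by rewrite subr0 addrK.
by rewrite stair_sumLR // addrK.
Qed.

(** * Words weighted by their descents *)

(** Here [e] letters precede [w], so a descent at its first letter has position [e.+1]. The default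
    [R] of [head] keeps a final R from being a descent. *)
Fixpoint word_weight (e : nat) (w : seq letter) : qtpoly :=
  if w is a :: w' then
    (if (a == R) && (head R w' == L) then qvar ^+ e.+1 * tvar else 1) *
    word_weight e.+1 w'
  else 1.

Definition stair_words (n e l k : nat) : qtpoly :=
  \sum_(w : n.-tuple letter | stair_word l k w) word_weight e w.

(* The words read after a first letter R, which they turn into a descent when
   they begin with L. *)
Definition stair_words_R (n e l k : nat) : qtpoly :=
  \sum_(w : n.-tuple letter | stair_word l k w) word_weight e (R :: w).

Lemma big_letter (F : letter -> qtpoly) : \sum_(a : letter) F a = F L + F R.
Proof.
rewrite (bigD1 L) //= (bigD1 R) //= big1 ?addr0 //; by case.
Qed.

Lemma stair_words0 e : stair_words 0 e 0 0 = 1.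
Proof. by rewrite /stair_words (big_tuple0 _ _ (stair_word 0 0)). Qed.

Lemma stair_wordsS n e l k :
  stair_words n.+1 e l k =
    (if l is l'.+1 then stair_words n e.+1 l' k else 0) +
    (if k is k'.+1 then if (g l <= k')%N then stair_words_R n e l k' else 0
     else 0).
Proof.
rewrite /stair_words (big_tuple_cons _ _ _ (stair_word l k)) big_letter /=.
congr (_ + _).
  case: l => [|l]; first by rewrite big_pred0_eq.
  by apply: eq_bigr => w _; rewrite mul1r.
case: k => [|k]; first by rewrite big_pred0_eq.
by case: leqP => // _; rewrite big_pred0_eq.
Qed.

Lemma stair_words_R0 e : stair_words_R 0 e 0 0 = 1.
Proof.
by rewrite /stair_words_R (big_tuple0 _ _ (stair_word 0 0)
  (fun w => word_weight e (R :: w))) /= mulr1.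
Qed.

(** The preceding R matters only for words beginning with L, which gain the factor [q^(e+1) t] of a
    new descent; the subtracted term corrects exactly these. *)
Lemma stair_words_RS n e l k :
  stair_words_R n.+1 e l k = stair_words n.+1 e.+1 l k -
    (1 - qvar ^+ e.+1 * tvar) *
    (if l is l'.+1 then stair_words n e.+2 l' k else 0).
Proof.
rewrite {1}/stair_words_R stair_wordsS (big_tuple_cons _ _ _ (stair_word l k)
  (fun w => word_weight e (R :: w))) big_letter.
set X := \sum_(s | _) _; set Y := \sum_(s | _) _.
have -> : X = qvar ^+ e.+1 * tvar *
    (if l is l'.+1 then stair_words n e.+2 l' k else 0).
  rewrite {}/X /=; case: l {Y} => [|l]; first by rewrite big_pred0_eq mulr0.
  by rewrite big_distrr; apply: eq_bigr => w _; rewrite mul1r.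
have -> : Y = if k is k'.+1 then if (g l <= k')%N then stair_words_R n e.+1 l k'
              else 0 else 0.
  rewrite {}/Y {X} /=; case: k => [|k]; first by rewrite big_pred0_eq.
  case: leqP => _ /=; last by rewrite big_pred0_eq.
  by apply: eq_bigr => w _; rewrite mul1r.
by rewrite mulrBl mul1r opprB [RHS]addrAC [_ + (_ - _)]addrC subrK.
Qed.

Lemma stair_words_R_row0 e k :
  stair_words_R k e 0 k = stair_words k e.+1 0 k.
Proof.
case: k => [|k]; first by rewrite stair_words_R0 stair_words0.
by rewrite stair_words_RS mulr0 subr0.
Qed.

(** Strong induction on the number [n] of letters left, because the recursion reaches the join of
    the two covers, two ranks up. The cell has rank [e], so the factors run from [e] to [h]. *)
Lemma stair_numerator n e l k :
  (g 0 = 0)%N -> (forall i j, (i <= j <= l)%N -> (g i <= g j)%N) ->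
  (g l <= k)%N -> (l + k = n)%N -> (e + n = h)%N ->
  has_numerator (fun m => stair_chains m l k)
    (\prod_(e <= a < h.+1) (1 - qvar ^+ a * tvar)) (stair_words n e l k).
Proof.
move=> g0; elim/ltn_ind: n e l k => n IH e l k gmono glk lkn enh.
have le_eh : (e < h.+1)%N by lia.
have IHle n' l' k' e' : (n' < n)%N -> (l' <= l)%N -> (g l' <= k')%N ->
    (l' + k' = n')%N -> (e' + n' = h)%N ->
    has_numerator (fun m => stair_chains m l' k')
      (\prod_(e' <= a < h.+1) (1 - qvar ^+ a * tvar)) (stair_words n' e' l' k').
  move=> nn ll gk lk en; apply: (IH n') => // i j /andP[ij jl].
  by apply: gmono; rewrite ij (leq_trans jl).
(* The factor of index [e] is absorbed into the series, leaving the chains that avoid the cell. *)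
rewrite big_ltn //; apply: (@has_numerator_conv _ (stair_diff l k)).
  by move=> m; rewrite conv_linear_factor /stair_diff -[X in (X - _)%N]enh -lkn addnK.
have glS : if l is l'.+1 then (g l' <= g l)%N else true.
  by case: l gmono {glk lkn IHle} => // l -> //; rewrite leqnSn leqnn.
case: l => [|l] in gmono glk lkn IHle glS *.
  rewrite add0n in lkn; subst n; case: k => [|k] in IH glk enh IHle *.
    (* At the top cell [e = h], so no factor remains and the series is 1. *)
    rewrite addn0 in enh; subst e; rewrite big_geq // stair_words0 => m.
    by rewrite conv1 stair_diff00 // coef1.
  rewrite stair_wordsS g0 add0r /= stair_words_R_row0.
  apply: (@eq_has_numerator _ (fun m => stair_chains m 0 k)).
    by move=> m; rewrite stair_diffR.
  by apply: IHle; rewrite ?g0 //; lia.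
(* In the first case the floor forbids R: the cell has one cover, and every word begins with L. *)
have [kg|gk] := boolP (if k is k'.+1 then (k' < g l.+1)%N else true).
  apply: (@eq_has_numerator _ (fun m => stair_chains m l k)).
    by move=> m; rewrite stair_diffL.
  rewrite -lkn addSn stair_wordsS.
  have -> : (if k is k'.+1 then if (g l.+1 <= k')%N
             then stair_words_R (l + k) e l.+1 k' else 0 else 0) = 0.
    by case: k kg {glk lkn IHle} => // k; rewrite ltnNge => /negbTE->.
  by rewrite addr0; apply: IHle; lia.
case: k => [|k] in glk lkn gk *; first by [].
rewrite -leqNgt in gk.
apply: (@eq_has_numerator _ (fun m =>
  stair_chains m l k.+1 + stair_chains m l.+1 k - stair_chains m l k)).
  by move=> m; rewrite stair_diffLR.
rewrite -lkn addSn addnS stair_wordsS gk stair_words_RS addrA.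
apply: has_numeratorB.
  by apply: has_numeratorD; apply: IHle; lia.
(* The join has rank [e + 2], so the factor of index [e + 1] is split off and multiplies its
   numerator. *)
rewrite big_ltn; last by lia.
by apply: has_numerator_mull; apply: IHle; lia.
Qed.

(** By monotonicity of [g], the tests made after each R imply the floor condition at every prefix;
    conversely, each test is an instance of that condition. *)
Lemma stair_wordP l k w :
  (forall i j, (i <= j <= l)%N -> (g i <= g j)%N) -> (g l <= k)%N ->
  reflect [/\ count_mem L w = l, count_mem R w = k &
      forall p, (g (l - count_mem L (take p w)) <= k - count_mem R (take p w))%N]
    (stair_word l k w).
Proof.
elim: w l k => [|[] w IH] l k gmono glk /=.
- apply: (iffP andP) => [[/eqP l0 /eqP k0]|[<- <- _] //].
  by split=> // p; rewrite !subn0.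
- case: l => [|l] in gmono glk *; first by constructor=> -[]; rewrite add1n.
  have gl : (g l <= k)%N by apply: leq_trans glk; apply: gmono; rewrite leqnSn leqnn.
  apply: (iffP (IH l k _ gl)).
  + by move=> i j /andP[ij jl]; apply: gmono; rewrite ij leqW.
  + by case=> cL cR pre; split=> [|//|[|p]] /=; rewrite ?cL ?subn0 // add0n subSS.
  + case=> [[cL] cR pre]; split=> // p.
    by have := pre p.+1; rewrite /= add0n subSS.
- case: k => [|k] in glk *; first by constructor=> -[_]; rewrite add1n.
  apply: (iffP andP) => [[glk' /(IH _ _ gmono glk')[cL cR pre]]|].
    by split=> [//||[|p]] /=; rewrite ?cR ?subn0 // add0n add1n subSS.
  (* The prefix consisting of the first R alone gives the floor test. *)
  case=> cL [cR] pre; have := pre 1%N.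
  rewrite /= take0 /= subn0 subSS subn0 => glk'; split=> //.
  apply/(IH _ _ gmono glk'); split=> // p.
  by have := pre p.+1; rewrite /= add0n subSS.
Qed.

(** The index [p] of the L, counted from 0, is the position of the preceding R counted from 1. *)
Lemma word_weightE e w :
  word_weight e w =
    \prod_(p < size w | [&& (1 <= p)%N, nth L w p.-1 == R & nth L w p == L])
      (qvar ^+ (e + p) * tvar).
Proof.
elim: w e => [|a w IH] e; first by rewrite big_ord0.
rewrite /= big_mkcond big_ord_recl /= mul1r IH.
case: w {IH} => [|c w]; first by rewrite !big_ord0 mulr1 andbF.
rewrite [in RHS]big_ord_recl /= addn1; congr (_ * _).
rewrite big_mkcond [LHS]big_ord_recl /= mul1r; apply: eq_bigr => p _.
by rewrite /bump !add1n addSnnS.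
Qed.

End Staircase.

(** * Intervals of the Ferrers-cell poset as staircase regions *)

Lemma ferrers_leE r b (u v : ferrers r b) :
  (u <= v)%O = (cell_row v <= cell_row u)%N && (cell_col u <= cell_col v)%N.
Proof. by []. Qed.

Lemma ferrers_cellP {r b} (u : ferrers r b) :
  [/\ (1 <= cell_row u)%N, (cell_row u <= r)%N, (cell_row u <= cell_col u)%N
    & (cell_col u <= b (cell_row u))%N].
Proof. by have /andP[/andP[? ?] /andP[? ?]] := valP u. Qed.

Section FerrersInterval.
Variables (r : nat) (b : nat -> nat) (x y : ferrers r b).

Definition row_gap (z : ferrers r b) : nat := (cell_row z - cell_row y)%N.
Definition col_gap (z : ferrers r b) : nat := (cell_col y - cell_col z)%N.
(** With [y = (j, d)], the bound [d - k <= b (j + l)] reads [d - b (j + l) <= k]; truncation gives 0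
    for rows reaching column [d]. *)
Definition col_floor (l : nat) : nat := (cell_col y - b (cell_row y + l))%N.

Lemma col_floor0 : col_floor 0 = 0%N.
Proof. by rewrite /col_floor addn0; have [_ _ _] := ferrers_cellP y; lia. Qed.

Lemma interval_cellP (z : order_interval x y) :
  [/\ (cell_row y <= cell_row (val z) <= cell_row x)%N,
      (cell_col x <= cell_col (val z) <= cell_col y)%N,
      (cell_row (val z) <= cell_col (val z))%N
    & (col_floor (row_gap (val z)) <= col_gap (val z))%N].
Proof.
have [z1 z2 z3 z4] := ferrers_cellP (val z).
have := valP z; rewrite !ferrers_leE /col_floor /row_gap /col_gap.
move=> /andP[/andP[? ?] /andP[? ?]]; split; rewrite ?subnKC //; lia.
Qed.

Lemma interval_leE (u z : order_interval x y) :
  (u <= z)%O = (row_gap (val z) <= row_gap (val u))%N &&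
               (col_gap (val z) <= col_gap (val u))%N.
Proof.
have [u1 u2 _ _] := interval_cellP u; have [z1 z2 _ _] := interval_cellP z.
change (u <= z)%O with (val u <= val z)%O; rewrite ferrers_leE /row_gap /col_gap; lia.
Qed.

Lemma interval_gap_inj :
  injective (fun z : order_interval x y => (row_gap (val z), col_gap (val z))).
Proof.
move=> u z [uz1 uz2]; apply/eqP.
by rewrite eq_le !interval_leE uz1 uz2 !leqnn.
Qed.

Notation rho := (interval_rank (x := x) (y := y) (@ferrers_rank r b)).

Lemma interval_rankE (z : order_interval x y) :
  rho z = (word_length x y - (row_gap (val z) + col_gap (val z)))%N.
Proof.
have [z1 z2 z3 _] := interval_cellP z; have [_ _ x3 _] := ferrers_cellP x.
rewrite /interval_rank /ferrers_rank /word_length /row_gap /col_gap.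
lia.
Qed.

Lemma descents_weight (w : (word_length x y).-tuple letter) :
  qvar ^+ (\sum_(p in descents w) p)%N * tvar ^+ #|descents w| =
    word_weight 0 w.
Proof.
rewrite word_weightE size_tuple expr_sum -prodr_const -big_split.
by apply: eq_big => [p|p _] /=; rewrite ?inE ?add0n.
Qed.

Hypothesis hxy : (x <= y)%O.

(** The cell is [(j + l, d - k)] for [x = (i, c)] and [y = (j, d)]. It satisfies the diagonal
    condition because [j + l <= i <= c <= d - k]. *)
Lemma exists_interval_cell l k :
  (l <= row_gap x)%N -> (k <= col_gap x)%N -> (col_floor l <= k)%N ->
  exists z : order_interval x y, row_gap (val z) = l /\ col_gap (val z) = k.
Proof.
have [x1 x2 x3 x4] := ferrers_cellP x; have [y1 y2 y3 y4] := ferrers_cellP y.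
move: (hxy); rewrite ferrers_leE /row_gap /col_gap /col_floor => ? lx kx flk.
have [|z [zr zc]] :=
  @exists_cell r b (cell_row y + l, cell_col y - k)%N; first by rewrite /is_cell /=; lia.
have zxy : (x <= z <= y)%O by rewrite !ferrers_leE zr zc; lia.
by exists (OrderInterval zxy); rewrite /= zr zc; lia.
Qed.

Lemma interval_sum (u : order_interval x y) (F : nat -> nat -> {poly int}) :
  \sum_(z : order_interval x y | (u <= z)%O)
      F (row_gap (val z)) (col_gap (val z)) =
    stair_sum col_floor F (row_gap (val u)) (col_gap (val u)).
Proof.
set l := row_gap _; set k := col_gap _.
pose gaps (z : order_interval x y) := (row_gap (val z), col_gap (val z)).
transitivity (\sum_(p <- [seq gaps z | z <- enum (fun z => (u <= z)%O)]) F p.1 p.2).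
  by rewrite big_map big_enum.
(* Both sums run over duplicate-free lists of gap pairs, so it suffices to compare their members. *)
transitivity (\sum_(p <- [seq (i, c) | i <- index_iota 0 l.+1,
    c <- [seq c <- index_iota 0 k.+1 | (col_floor i <= c)%N]]) F p.1 p.2).
  apply: perm_big; apply: uniq_perm.
  - by rewrite map_inj_uniq ?enum_uniq //; apply: interval_gap_inj.
  - apply: allpairs_uniq_dep => [|i _|]; rewrite ?iota_uniq ?filter_uniq ?iota_uniq //.
    by move=> [i c] [i' c'] _ _ /= [-> ->].
  move=> [i c]; apply/mapP/allpairsPdep.
    case=> z; rewrite mem_enum unfold_in interval_leE => /andP[zi zc] [-> ->].
    have [_ _ _ fl] := interval_cellP z.
    exists (row_gap (val z)), (col_gap (val z)).
    by rewrite mem_filter !mem_index_iota !ltnS /= fl zi zc.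
  case=> i' [c' []]; rewrite mem_filter !mem_index_iota !ltnS => il.
  case/andP=> fl ck [-> ->].
  have [u1 u2 _ _] := interval_cellP u.
  have [|||z [z1 z2]] := @exists_interval_cell i' c' => //.
  - by move: il; rewrite /l /row_gap; lia.
  - by move: ck; rewrite /k /col_gap; lia.
  exists z; last by rewrite /gaps z1 z2.
  by rewrite mem_enum unfold_in interval_leE z1 z2; apply/andP.
rewrite big_allpairs_dep /stair_sum big_mkord; apply: eq_bigr => i _.
by rewrite big_filter big_mkord.
Qed.

Lemma interval_chain_sum m (u : order_interval x y) :
  chain_sum rho m u =
    stair_chains col_floor (word_length x y) m (row_gap (val u)) (col_gap (val u)).
Proof.
elim: m u => [|m IH] u.
  rewrite /chain_sum (big_tuple0 _ _ (path <=%O u)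
    (fun s => 'X^(\sum_(z <- s) rho z)%N)) /=.
  by rewrite big_nil expr0.
rewrite chain_sumS /= -interval_sum; apply: eq_bigr => z _.
by rewrite IH interval_rankE.
Qed.

Lemma interval_max_rank : max_rank rho = word_length x y.
Proof.
have yin : (x <= y <= y)%O by rewrite hxy lexx.
apply/eqP; rewrite eqn_leq; apply/andP; split.
  by apply/bigmax_leqP => z _; rewrite interval_rankE leq_subr.
have := leq_bigmax (F := rho) (OrderInterval yin).
by rewrite interval_rankE /row_gap /col_gap /= !subnn subn0.
Qed.

Lemma prefix_col_floor a e :
  (a <= row_gap x)%N -> (e <= col_gap x)%N ->
  (col_floor (row_gap x - a) <= col_gap x - e)%N =
    (cell_col x + e <= b (cell_row x - a))%N.
Proof.
move: (hxy); rewrite ferrers_leE /col_floor /row_gap /col_gap => ? ax ey.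
have -> : (cell_row y + (cell_row x - cell_row y - a) = cell_row x - a)%N by lia.
lia.
Qed.

Hypothesis hmono : forall i j : nat, (1 <= i)%N -> (i <= j)%N -> (j <= r)%N ->
  (b j <= b i)%N.

(** Rows farther from [y] have larger index, hence are no longer, so their floor is no lower. *)
Lemma col_floor_mono i j :
  (i <= j <= row_gap x)%N -> (col_floor i <= col_floor j)%N.
Proof.
have [x1 x2 x3 x4] := ferrers_cellP x; have [y1 y2 y3 y4] := ferrers_cellP y.
move: hxy; rewrite ferrers_leE /row_gap => ? ?; apply: leq_sub2l.
by apply: hmono; lia.
Qed.

Lemma in_words w :
  (w \in words x y) = stair_word col_floor (row_gap x) (col_gap x) w.
Proof.
have flx : (col_floor (row_gap x) <= col_gap x)%N.
  have := prefix_col_floor 0 0 isT isT; rewrite !subn0 addn0 => ->.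
  by have [] := ferrers_cellP x.
have count_take (z : letter) p : (count_mem z (take p w) <= count_mem z w)%N.
  by rewrite -{2}(cat_take_drop p w) count_cat leq_addr.
rewrite inE; apply/and3P/(stair_wordP _ _ _ _ col_floor_mono flx).
  case=> /eqP cL /eqP cR /forallP pre; split=> // p.
  rewrite prefix_col_floor -?[row_gap _]cL -?[col_gap _]cR //.
  have [pn|np] := ltnP p (word_length x y).+1; first exact: (pre (Ordinal pn)).
  (* A prefix length beyond the end of the word gives the whole word again. *)
  have := pre ord_max; rewrite !take_oversize ?size_tuple //.
  exact: ltnW.
case=> cL cR pre; split; rewrite ?cL ?cR //; apply/forallP => p.
by have := pre p; rewrite prefix_col_floor // -?cL -?cR.
Qed.

End FerrersInterval.

Theorem proposition5p10 (r : nat) (b : nat -> nat)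
    (hr : (1 <= r)%N)
    (hmono : forall i j : nat, (1 <= i)%N -> (i <= j)%N -> (j <= r)%N ->
       (b j <= b i)%N)
    (hb : forall i : nat, (1 <= i)%N -> (i <= r)%N -> (i <= b i)%N)
    (x y : ferrers r b) (hxy : (x <= y)%O) :
  is_qzeta_numerator (interval_rank (x := x) (y := y) (@ferrers_rank r b))
    (\sum_(w in words x y)
       qvar ^+ (\sum_(p in descents w) p)%N * tvar ^+ #|descents w|).
Proof.
have xin : (x <= x <= y)%O by rewrite lexx hxy.
have [_ _ _ flx] := interval_cellP _ _ _ _ (OrderInterval xin).
(* Taken at [x] itself, whose induced rank is 0, so that all factors of the denominator occur. *)
have num := stair_numerator _ _ _ _ _ _ (col_floor0 _ _ y)
  (col_floor_mono _ _ _ _ hxy hmono) flx erefl (add0n _).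
move=> n; rewrite /qzeta_denom interval_max_rank //.
rewrite (eq_bigr _ (fun w _ => descents_weight _ _ _ _ w)).
rewrite (eq_bigl _ _ (in_words _ _ _ _ hxy hmono)) -[RHS]num.
apply: eq_bigr => m _; congr (_ * _).
rewrite (qzeta_coef_chain_sum _ _ _ _ (OrderInterval xin)) ?interval_chain_sum //.
by move=> z; case/andP: (valP z).
Qed.
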